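(* Let $\mathcal{A}$ be a unital $C^*$-algebra, $\mathcal{H}$ a Hilbert space, $n,k\ge1$, $m=\lfloor (k+1)/2\rfloor$, and let $\varphi=[\varphi_{ij}]:M_n(\mathcal{A})^k\to M_n(\mathcal{B}(\mathcal{H}))$ be an invariant completely positive block $k$-linear map. Let $\left(\{\pi_i^{(p)}\}_{i=1}^m,\{V_i^{(p)}\}_{i=1}^n,\mathcal{K}^{(p)}\right)$, $p=1,2$, be two minimal Stinespring triples of $\varphi$. Then there exists a unitary operator $U:\mathcal{K}^{(1)}\to\mathcal{K}^{(2)}$ such that (1) $\pi_1^{(2)}(a_1)\cdots\pi_m^{(2)}(a_m)U=U\pi_1^{(1)}(a_1)\cdots\pi_m^{(1)}(a_m)$ for all $a_1,\ldots,a_m\in\mathcal{A}$; (2) $UV_i^{(1)}=V_i^{(2)}$ for all $1\le i\le n$.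
   Context: Block maps: given $k$-linear maps $\varphi_{ij}:\mathcal{A}^k\to\mathcal{B}(\mathcal{H})$, $1\le i,j\le n$, the block $k$-linear map $\varphi=[\varphi_{ij}]:M_n(\mathcal{A})^k\to M_n(\mathcal{B}(\mathcal{H}))$ sends $(A_1,\ldots,A_k)$, $A_l=[a_{l,ij}]$, to the matrix with $(i,j)$ entry $\sum_{r_1,\ldots,r_{k-1}=1}^n\varphi_{ij}(a_{1,ir_1},a_{2,r_1r_2},\ldots,a_{k,r_{k-1}j})$. Positivity: a $k$-linear map $\Phi$ from $\mathcal{C}^k$ to $\mathcal{D}$ ($\mathcal{C},\mathcal{D}$ unital $C^*$-algebras) is positive if $\Phi(x_1,\ldots,x_k)\ge0$ whenever $(x_1,\ldots,x_k)=(x_k^*,\ldots,x_1^* )$, with the additional assumption $x_m\ge0$ when $k=2m-1$ is odd. Complete positivity: for $t\in\mathbb{N}$ the $t$-amplification $\varphi_t:M_t(M_n(\mathcal{A}))^k\to M_t(M_n(\mathcal{B}(\mathcal{H})))$ sends $([A_{1,ij}],\ldots,[A_{k,ij}])$, with $A_{l,ij}\in M_n(\mathcal{A})$, to the $t\times t$ block matrix with $(i,j)$ entry $\sum_{r_1,\ldots,r_{k-1}=1}^t\varphi(A_{1,ir_1},A_{2,r_1r_2},\ldots,A_{k,r_{k-1}j})$. The block map $\varphi$ is completely positive if $\varphi_t$ is positive for all $t\in\mathbb{N}$. Invariance: $\varphi$ is invariant if, when $k=2m-1$, $\varphi(A_1C_1,\ldots,A_{m-1}C_{m-1},A_m,A_{m+1},\ldots,A_{2m-1})=\varphi(A_1,\ldots,A_{m-1},A_m,C_{m-1}A_{m+1},\ldots,C_1A_{2m-1})$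 for all $A_l,C_l\in M_n(\mathcal{A})$; and, when $k=2m$, $\varphi(A_1C_1,\ldots,A_mC_m,A_{m+1},\ldots,A_{2m})=\varphi(A_1,\ldots,A_m,C_mA_{m+1},\ldots,C_1A_{2m})$ for all $A_l,C_l\in M_n(\mathcal{A})$. Stinespring triple: a triple $(\{\pi_i\}_{i=1}^m,\{V_i\}_{i=1}^n,\mathcal{K})$ consisting of a Hilbert space $\mathcal{K}$, unital $*$-homomorphisms $\pi_1,\ldots,\pi_m:\mathcal{A}\to\mathcal{B}(\mathcal{K})$ with mutually commuting ranges, and $V_i\in\mathcal{B}(\mathcal{H},\mathcal{K})$, is a Stinespring triple of $\varphi$ if for all $1\le i,j\le n$ and all $a_l\in\mathcal{A}$: $\varphi_{ij}(a_1,\ldots,a_{2m-1})=V_i^*\pi_1(a_m)\pi_2(a_{m-1}a_{m+1})\cdots\pi_m(a_1a_{2m-1})V_j$ when $k=2m-1$, and $\varphi_{ij}(a_1,\ldots,a_{2m})=V_i^*\pi_1(a_ma_{m+1})\pi_2(a_{m-1}a_{m+2})\cdots\pi_m(a_1a_{2m})V_j$ when $k=2m$. It is minimal if $\mathcal{K}=\overline{\mathrm{span}}\left\{\pi_1(\mathcal{A})\cdots\pi_m(\mathcal{A})\left(\sum_{i=1}^nV_i\mathcal{H}\right)\right\}$. *)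

(* Defs.v *)
From HB Require Import structures.
From mathcomp Require Import all_boot all_order all_algebra.
From mathcomp Require Import complex sesquilinear.
From mathcomp Require Import boolp classical_sets functions reals topology.
From mathcomp Require Import normedtype.
From mathcomp Require Import ring lra.

Set Implicit Arguments.
Unset Strict Implicit.
Unset Printing Implicit Defensive.

Import Order.TTheory GRing.Theory Num.Theory.
Import numFieldNormedType.Exports.

Local Open Scope classical_set_scope.
Local Open Scope ring_scope.

Definition Cx (R : realType) : numClosedFieldType := R[i].

(* `dotp` is linear in its first argument and conjugate linear in its second
   argument; completeness is that of the norm it induces. *)
HB.mixin Record CompleteNormedModule_isHilbert (R : realType) H
    of CompleteNormedModule (Cx R) H := {
  dotp : {dot H for (@Num.conj (Cx R))};
  dotp_normE : forall x : H, `|x| ^+ 2 = dotp x x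
}.

#[short(type="hilbertType")]
HB.structure Definition Hilbert (R : realType) :=
  {H of CompleteNormedModule (Cx R) H & CompleteNormedModule_isHilbert R H}.

Section DotpTheory.
Variables (R : realType) (H : hilbertType R).
Implicit Types x y z : H.
Local Notation "<( x , y )>" := (@dotp R H x y).

Lemma dotpC x y : <(x, y)> = <(y, x)>^*.
Proof. by rewrite (hermC (@dotp R H)) expr0 mul1r. Qed.

Lemma dotpDl x y z : <(x + y, z)> = <(x, z)> + <(y, z)>.
Proof. exact: linearDl. Qed.

Lemma dotpZl a x y : <(a *: x, y)> = a * <(x, y)>.
Proof. exact: linearZl_LR. Qed.

Lemma dotpDr x y z : <(x, y + z)> = <(x, y)> + <(x, z)>.
Proof. by rewrite dotpC dotpDl (dotpC x y) (dotpC x z) rmorphD. Qed.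

Lemma dotpZr a x y : <(x, a *: y)> = a^* * <(x, y)>.
Proof. by rewrite dotpC dotpZl (dotpC x y) rmorphM. Qed.

Lemma dotpNl x y : <(- x, y)> = - <(x, y)>.
Proof. by rewrite -scaleN1r dotpZl mulN1r. Qed.

Lemma dotpNr x y : <(x, - y)> = - <(x, y)>.
Proof. by rewrite -scaleN1r dotpZr rmorphN rmorph1 mulN1r. Qed.

Lemma dotpBl x y z : <(x - y, z)> = <(x, z)> - <(y, z)>.
Proof. by rewrite dotpDl dotpNl. Qed.

Lemma dotpBr x y z : <(x, y - z)> = <(x, y)> - <(x, z)>.
Proof. by rewrite dotpDr dotpNr. Qed.

Lemma dotpr0 x : <(x, 0)> = 0.
Proof. by rewrite -(subrr x) dotpBr subrr. Qed.

Lemma dotp_injr x y : (forall z, <(z, x)> = <(z, y)>) -> x = y.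
Proof.
move=> e; apply/subr0_eq/normr0_eq0/eqP; rewrite -sqrf_eq0 dotp_normE.
by rewrite dotpBr !e subrr.
Qed.

Lemma dotp_injl x y : (forall z, <(x, z)> = <(y, z)>) -> x = y.
Proof.
by move=> e; apply: dotp_injr => z; rewrite dotpC e -dotpC.
Qed.

Lemma dotp_CauchySchwarz x y : `|<(x, y)>| <= `|x| * `|y|.
Proof.
have [->|y0] := eqVneq y 0; first by rewrite dotpr0 !normr0 mulr0.
have yy0 : 0 < `|y| ^+ 2 by rewrite exprn_gt0 ?normr_gt0.
rewrite -ler_sqr ?nnegrE ?mulr_ge0// exprMn -ler_pdivrMr//.
set n2 := `|y| ^+ 2 in yy0 *.
rewrite -subr_ge0; set a := <(x, y)> / n2.
suff -> : `|x| ^+ 2 - `|<(x, y)>| ^+ 2 / n2 = `|x - a *: y| ^+ 2.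
  exact: exprn_ge0.
have n2J : n2^* = n2 by apply/CrealP; rewrite realX.
have n20 : n2 != 0 by rewrite gt_eqF.
rewrite dotp_normE [RHS]dotp_normE dotpBl !dotpBr !(dotpZr, dotpZl) -(dotp_normE y).
rewrite -/n2 (dotpC y x) normCK rmorphM /= fmorphV /= n2J.
set d := <(x, y)>; rewrite /a -/d.
by field.
Qed.

End DotpTheory.

Lemma real_inf (R : realType) (S : set (Cx R)) (l : Cx R) :
  S !=set0 -> (forall x, S x -> l <= x) -> l \is Num.real ->
  exists2 j : Cx R, (forall x, S x -> j <= x) &
    forall e : Cx R, 0 < e -> exists2 x, S x & x < j + e.
Proof.
move=> [s0 Ss0] lS lreal.
have Iml : complex.Im (l : R[i]) = 0.
  by move: lreal; rewrite realE => /orP[]; rewrite lecE => /andP[/eqP].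
pose re (z : Cx R) : R := complex.Re (z : R[i]).
have SE x : S x -> x = real_complex R (re x) /\ re l <= re x.
  move=> /lS; rewrite /re; case: x => a b; rewrite lecE /= Iml => /andP[/eqP -> ?].
  by split.
have reS : has_inf (re @` S).
  split; first by exists (re s0), s0.
  by exists (re l) => _ [x /SE[_ ?] <-].
exists (real_complex R (inf (re @` S))) => [x Sx|e e0].
  rewrite (SE _ Sx).1 lecE /= eqxx /=.
  by apply: ge_inf; [exact: reS.2|exists x].
have Ime : complex.Im (e : R[i]) = 0 by move: e0; rewrite ltcE => /andP[/eqP].
have re0 : 0 < re e by move: e0; rewrite ltcE => /andP[].
have [_ [x Sx <-] xe] := inf_adherent re0 reS.
exists x => //; rewrite (SE _ Sx).1 ltcE; move: xe Ime; rewrite /re.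
by case: (e) => a b /= ? ->; rewrite addr0 eqxx.
Qed.

Lemma Riesz (R : realType) (H : hilbertType R) (f : H -> Cx R) (M : Cx R) :
  (forall x y, f (x + y) = f x + f y) -> (forall a x, f (a *: x) = a * f x) ->
  (forall x, `|f x| <= M * `|x|) -> exists z, forall x, f x = dotp x z.
Proof.
move=> fD fZ fM.
have [|M0] := boolP (0 <= M); last first.
  exists 0 => x; rewrite dotpr0; apply/normr0_eq0/le_anti/andP; split => //.
  have := fM x; have [->|x0] := eqVneq x 0; first by rewrite normr0 mulr0.
  move=> /(le_trans (normr_ge0 _)); rewrite pmulr_lge0 ?normr_gt0//.
  by rewrite (negbTE M0).
move=> M0.
have fN x : f (- x) = - f x by rewrite -scaleN1r fZ mulN1r.
pose J x : Cx R := `|x| ^+ 2 - f x - (f x)^*.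
have JM x : - M ^+ 2 <= J x.
  have ux : 'Re (f x) <= M * `|x| by apply: le_trans (fM x); exact: leif_Re_Creal.
  have -> : J x = `|x| ^+ 2 - 2 * 'Re (f x) by rewrite /J ReE; field.
  have : 0 <= (`|x| - M) ^+ 2.
    by rewrite real_exprn_even_ge0// realB// ger0_real.
  move=> sq; rewrite -subr_ge0.
  have -> : `|x| ^+ 2 - 2 * 'Re (f x) - - M ^+ 2 =
    (`|x| - M) ^+ 2 + 2 * (M * `|x| - 'Re (f x)) by ring.
  by rewrite addr_ge0// mulr_ge0// subr_ge0.
have [|s [x _ <-]||j jJ Jj] := @real_inf R (range J) (- M ^+ 2).
- by exists (J 0), 0.
- exact: JM.
- by rewrite realN realX ?ger0_real.
have {}jJ x : j <= J x by apply: jJ; exists x.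
pose B (e : Cx R) := [set x | J x < j + e].
pose F := filter_from [set e : Cx R | 0 < e] B.
have FF : ProperFilter F.
  apply: filter_from_proper; last first.
    by move=> e e0; have [_ [x _ <-] xe] := Jj _ e0; exists x.
  apply: filter_from_filter; first by exists 1; exact: ltr01.
  move=> e1 e2 /= e10 e20.
  have /orP[le|le] : (e1 <= e2) || (e2 <= e1) by exact: real_comparable (gtr0_real e10) (gtr0_real e20).
    exists e1 => // x Jx; split => //; apply: (lt_le_trans Jx); by rewrite lerD2l.
  exists e2 => // x Jx; split => //; apply: (lt_le_trans Jx); by rewrite lerD2l.
have JB e x y : J x < j + e -> J y < j + e -> `|x - y| ^+ 2 <= 4 * e.
  move=> /ltW Jx /ltW Jy; have := jJ (2^-1 *: (x + y)).
  have -> : `|x - y| ^+ 2 = 2 * (J x + J y) - 4 * J (2^-1 *: (x + y)).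
    rewrite /J !dotp_normE !(dotpBl, dotpBr, dotpDl, dotpDr, dotpZl, dotpZr).
    rewrite !(fZ, fD) !(rmorphM, rmorphD) /= !fmorphV /= !conjC_nat.
    by field.
  move=> Jh; rewrite lerBlDr.
  have -> : 4 * e + 4 * J (2^-1 *: (x + y)) =
    2 * ((j + e) + (j + e)) + 4 * (J (2^-1 *: (x + y)) - j) by ring.
  apply: ler_wpDr; first by rewrite mulr_ge0 ?subr_ge0 ?ler0n.
  by rewrite ler_pM2l ?ltr0n// lerD.
have /cauchy_cvg/cvg_ex[z Fz] : cauchy F.
  apply/cauchyP => e e0.
  have d0 : 0 < e ^+ 2 / 5 by rewrite divr_gt0 ?exprn_gt0.
  have [_ [x _ <-] xe] := Jj _ d0.
  exists x, (e ^+ 2 / 5) => // y /= ye; rewrite -ball_normE /=.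
  rewrite -ltr_sqr ?nnegrE ?(ltW e0)//; apply: le_lt_trans (JB _ _ _ xe ye) _.
  rewrite mulrCA gtr_pMr ?exprn_gt0//.
  by rewrite ltr_pdivrMr// mul1r ltr_nat.
have Jf e x h : 0 < e -> J x < j + e -> 
  `|dotp h x - f h| ^+ 2 <= e * (`|h| ^+ 2 + 1).
  move=> e0 Jx; set D := dotp h x - f h; set p := `|h| ^+ 2 + 1.
  have p0 : 0 < p by rewrite ltr_wpDl// exprn_ge0.
  have pn0 : p != 0 by rewrite gt_eqF.
  have pJ : p^* = p by apply/conj_Creal/gtr0_real.
  have := jJ (x - (D^* / p) *: h).
  have -> : J (x - (D^* / p) *: h) =
    J x - `|D| ^+ 2 / p - `|D| ^+ 2 / p ^+ 2.
    rewrite /J !dotp_normE !(dotpBl, dotpBr, dotpZl, dotpZr) -(dotp_normE h).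
    have -> : `|h| ^+ 2 = p - 1 by rewrite /p addrK.
    rewrite !(fZ, fD, fN) !(rmorphM, rmorphD, rmorphN) /= !fmorphV /= pJ conjCK.
    rewrite normCK (dotpC x h) /D rmorphB /= ?conjCK.
    by field.
  move=> jx; rewrite -ler_pdivrMr//.
  have : 0 <= `|D| ^+ 2 / p ^+ 2 by rewrite divr_ge0// exprn_ge0// ltW.
  move: jx (ltW Jx); set N := _ / p; set N2 := _ / p ^+ 2 => jx Jx' N20.
  have -> : N = j + N - j by ring.
  rewrite lerBlDl; apply: le_trans Jx'.
  rewrite -lerBrDr; apply: (le_trans jx); by rewrite gerBl.
exists z => h; apply/eqP; rewrite -subr_eq0 -normr_eq0; apply/negP => /negP.
rewrite -normr_gt0 normr_id distrC; set D0 := `|_| => D00.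
have p0 : 0 < `|h| ^+ 2 + 1 by rewrite ltr_wpDl// exprn_ge0.
have q0 : 0 < `|h| + 1 by rewrite ltr_wpDl.
pose e := (D0 / 2) ^+ 2 / (`|h| ^+ 2 + 1).
have e0 : 0 < e by rewrite divr_gt0// exprn_gt0// divr_gt0.
have r0 : 0 < D0 / (2 * (`|h| + 1)) by rewrite divr_gt0// mulr_gt0.
have FB : F (B e) by exists e.
have Fball : F (ball z (D0 / (2 * (`|h| + 1)))) by apply: Fz; exact: nbhsx_ballx.
have [x [Jx]] := filter_ex (filterI FB Fball).
rewrite -ball_normE /= => zx.
have := Jf _ _ h e0 Jx.
rewrite /e divfK ?gt_eqF// ler_sqr ?nnegrE ?divr_ge0 ?(ltW D00)// => hx.
suff : D0 < D0 by rewrite ltxx.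
have D0E : D0 = `|dotp h (z - x) + (dotp h x - f h)|.
  by rewrite /D0 dotpBr addrA subrK.
rewrite [X in X < _]D0E.
apply: (le_lt_trans (ler_normD _ _)).
suff : `|dotp h (z - x)| < D0 / 2.
  by move=> /ltr_leD/(_ hx); rewrite -splitr.
apply: (le_lt_trans (dotp_CauchySchwarz _ _)).
apply: (@le_lt_trans _ _ (`|h| * (D0 / (2 * (`|h| + 1))))).
  by rewrite ler_wpM2l// ltW.
have -> : D0 / 2 = (`|h| + 1) * (D0 / (2 * (`|h| + 1))).
  by field; rewrite gt_eqF.
by rewrite ltr_pM2r// ltrDl.
Qed.

Section BoundedOperators.
Variables (R : realType) (H K : hilbertType R).

Definition bounded_op : {pred H -> K} :=
  fun T => `[< linear T /\ continuous T >].

Record bop := Bop { bop_fun :> H -> K; _ : bop_fun \in bounded_op }.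

HB.instance Definition _ := [isSub for bop_fun].
HB.instance Definition _ := [Choice of bop by <:].

Lemma bounded_opP (T : H -> K) :
  linear T -> (exists M, forall x, `|T x| <= M * `|x|) -> T \in bounded_op.
Proof.
move=> Tlin [M TM]; apply/asboolP; split => //.
pose TL : {linear H -> K} :=
  HB.pack T (GRing.isLinear.Build (Cx R) H K *:%R T Tlin).
have : continuous TL; last by [].
have [M0|M0] := boolP (0 <= M).
  apply: bounded_linear_continuous; apply/linear_boundedP.
  exists M; split; first exact: ger0_real.
  by move=> r /ltW Mr x; apply: le_trans (TM x) _; rewrite ler_wpM2r.
have x0 (x : H) : x = 0.
  apply/eqP/negP => /negP x0; have := TM x.
  move=> /(le_trans (normr_ge0 _)); rewrite pmulr_lge0 ?normr_gt0//.
  by rewrite (negbTE M0).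
apply: bounded_linear_continuous; apply/linear_boundedP.
exists 0; split; first exact: real0.
by move=> r r0 x; rewrite (x0 x) linear0 !normr0 mulr0.
Qed.

Lemma bop_bounded (T : bop) :
  exists2 M, 0 < M & forall x, `|T x| <= M * `|x|.
Proof.
case: T => T /= /asboolP[Tlin Tcont].
pose TL : {linear H -> K} :=
  HB.pack T (GRing.isLinear.Build (Cx R) H K *:%R T Tlin).
have /linear_boundedP/pinfty_ex_gt0[M M0 TM] : bounded_near TL (nbhs 0).
  exact/continuous_linear_bounded/Tcont.
by exists M.
Qed.

Lemma bopP (T : bop) : linear T /\ continuous T.
Proof. by case: T => T /= /asboolP. Qed.

HB.instance Definition _ (T : bop) :=
  GRing.isLinear.Build (Cx R) H K *:%R T (bopP T).1.

Lemma bop_ext (S T : bop) : (forall x, S x = T x) -> S = T.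
Proof. by move=> e; apply/val_inj/funext. Qed.

Fact bounded_op_submod_closed : submod_closed bounded_op.
Proof.
split.
  apply: bounded_opP; first by move=> a x y; rewrite scaler0 addr0.
  by exists 0 => x; rewrite normr0 mul0r.
move=> a S T SB TB.
have [M M0 SM] := bop_bounded (Bop SB); have [N N0 TN] := bop_bounded (Bop TB).
apply: bounded_opP.
  move=> b x y.
  change (a *: S (b *: x + y) + T (b *: x + y) =
    b *: (a *: S x + T x) + (a *: S y + T y)).
  have [Slin _] := bopP (Bop SB); have [Tlin _] := bopP (Bop TB).
  by rewrite [S _]Slin [T _]Tlin /= !scalerDr !scalerA (mulrC b) addrACA.
exists (`|a| * M + N) => x; apply: le_trans (ler_normD _ _) _.
rewrite mulrDl; apply: lerD; last exact: TN.
by rewrite normrZ -mulrA ler_wpM2l//; exact: SM.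
Qed.

HB.instance Definition _ :=
  GRing.isSubmodClosed.Build (Cx R) (H -> K) bounded_op bounded_op_submod_closed.

HB.instance Definition _ := [SubChoice_isSubLmodule of bop by <:].

Lemma bopD (S T : bop) x : (S + T) x = S x + T x. Proof. by []. Qed.
Lemma bopZ a (T : bop) x : (a *: T) x = a *: T x. Proof. by []. Qed.

End BoundedOperators.
Arguments bounded_op {R H K}.

Section Composition.
Variables (R : realType) (H K L : hilbertType R).

Fact bop_comp_subproof (S : bop K L) (T : bop H K) :
  (S \o T : H -> L) \in bounded_op.
Proof.
have [M M0 SM] := bop_bounded S; have [N N0 TN] := bop_bounded T.
apply: bounded_opP; first by move=> a x y; rewrite /= !linearP.
exists (M * N) => x /=; apply: le_trans (SM _) _.
by rewrite -mulrA ler_wpM2l// ltW.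
Qed.

Definition bop_comp S T : bop H L := Bop (bop_comp_subproof S T).

End Composition.
Infix "\ob" := bop_comp (at level 50, left associativity).

Section EndomorphismRing.
Variables (R : realType) (H : hilbertType R).

Fact bop_id_subproof : (idfun : H -> H) \in bounded_op.
Proof. by apply: bounded_opP => //; exists 1 => x; rewrite mul1r. Qed.

Definition bop_id : bop H H := Bop bop_id_subproof.

Fact bop_compA : associative (@bop_comp R H H H).
Proof. by move=> S T U; apply: bop_ext. Qed.
Fact bop_comp1l : left_id bop_id (@bop_comp R H H H).
Proof. by move=> S; apply: bop_ext. Qed.
Fact bop_comp1r : right_id bop_id (@bop_comp R H H H).
Proof. by move=> S; apply: bop_ext. Qed.
Fact bop_compDl : left_distributive (@bop_comp R H H H) +%R.
Proof. by move=> S T U; apply: bop_ext. Qed.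
Fact bop_compDr : right_distributive (@bop_comp R H H H) +%R.
Proof. by move=> S T U; apply: bop_ext => x; exact: linearD. Qed.

HB.instance Definition _ := GRing.Zmodule_isPzRing.Build (bop H H)
  bop_compA bop_comp1l bop_comp1r bop_compDl bop_compDr.

End EndomorphismRing.

Section Adjoint.
Variables (R : realType) (H K : hilbertType R).

Lemma adjoint_exists (T : bop H K) :
  exists S : bop K H, forall x y, dotp (T x) y = dotp x (S y).
Proof.
have [M M0 TM] := bop_bounded T.
have /choice[S SP] : forall y, exists z, forall x, dotp (T x) y = dotp x z.
  move=> y; apply: (@Riesz _ _ (fun x => dotp (T x) y) (M * `|y|)).
  - by move=> x x'; rewrite linearD dotpDl.
  - by move=> a x; rewrite linearZ dotpZl.
  - move=> x; apply: le_trans (dotp_CauchySchwarz _ _) _.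
    by rewrite mulrAC ler_wpM2r.
have SB : S \in bounded_op.
  apply: bounded_opP.
    by move=> a y z; apply: dotp_injr => x; rewrite dotpDr dotpZr -!SP dotpDr dotpZr.
  exists M => y; have [->|Sy0] := eqVneq (S y) 0.
    by rewrite normr0 mulr_ge0// ltW.
  rewrite -(@ler_pM2r _ `|S y|) ?normr_gt0// -expr2 dotp_normE -SP.
  rewrite -[leLHS]ger0_norm; last by rewrite SP -dotp_normE exprn_ge0.
  apply: le_trans (dotp_CauchySchwarz _ _) _.
  by rewrite mulrAC ler_wpM2r.
by exists (Bop SB).
Qed.

Definition adjoint (T : bop H K) : bop K H := sval (cid (adjoint_exists T)).

Lemma adjointP (T : bop H K) x y : dotp (T x) y = dotp x (adjoint T y).
Proof. exact: (svalP (cid (adjoint_exists T))). Qed.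

End Adjoint.

HB.mixin Record PzRing_isStarRing A of GRing.PzRing A := {
  star : A -> A;
  starK : involutive star;
  starD : {morph star : x y / x + y};
  starM : forall x y, star (x * y) = star y * star x
}.

#[short(type="starRingType")]
HB.structure Definition StarRing := {A of PzRing_isStarRing A & GRing.PzRing A}.

Lemma star0 (A : starRingType) : star 0 = 0 :> A.
Proof. by apply: (@addrI _ (star 0)); rewrite -starD !addr0. Qed.

Section BopStar.
Variables (R : realType) (H : hilbertType R).
Implicit Types S T : bop H H.

Fact adjointK : involutive (@adjoint R H H).
Proof.
move=> T; apply: bop_ext => x; apply: dotp_injl => y.
by rewrite dotpC -adjointP -dotpC -adjointP.
Qed.

Fact adjointD : {morph @adjoint R H H : S T / S + T}.
Proof.
move=> S T; apply: bop_ext => y; apply: dotp_injr => x.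
by rewrite -adjointP !bopD dotpDl dotpDr !adjointP.
Qed.

Fact adjointM S T : adjoint (S * T) = adjoint T * adjoint S.
Proof.
by apply: bop_ext => y; apply: dotp_injr => x; rewrite -adjointP /= !adjointP.
Qed.

HB.instance Definition _ :=
  PzRing_isStarRing.Build (bop H H) adjointK adjointD adjointM.

End BopStar.

Section MatrixStar.
Variables (A : starRingType) (n : nat).

Definition star_mx (M : 'M[A]_n) : 'M[A]_n := \matrix_(i, j) star (M j i).

Fact star_mxK : involutive star_mx.
Proof. by move=> M; apply/matrixP => i j; rewrite !mxE starK. Qed.

Fact star_mxD : {morph star_mx : M N / M + N}.
Proof. by move=> M N; apply/matrixP => i j; rewrite !mxE starD. Qed.

Fact star_mxM M N : star_mx (M * N) = star_mx N * star_mx M.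
Proof.
apply/matrixP => i j; rewrite !mxE (big_morph _ (@starD A) (star0 A)).
by apply: eq_bigr => k _; rewrite !mxE starM.
Qed.

HB.instance Definition _ :=
  PzRing_isStarRing.Build 'M[A]_n star_mxK star_mxD star_mxM.

End MatrixStar.

(* The ring operations are fields of this mixin and the ring instance is derived
   below: MathComp has no structure joining rings and normed modules.  The unit
   is not required to be nonzero, so the zero algebra is included, as is B(H)
   for H = 0. *)
HB.mixin Record CompleteNormedModule_isCStarAlgebra (R : realType) A
    of CompleteNormedModule (Cx R) A := {
  cstar_mul : A -> A -> A;
  cstar_one : A;
  cstar_star : A -> A;
  cstar_mulA : associative cstar_mul;
  cstar_mul1l : left_id cstar_one cstar_mul;
  cstar_mul1r : right_id cstar_one cstar_mul;
  cstar_mulDl : left_distributive cstar_mul +%R;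
  cstar_mulDr : right_distributive cstar_mul +%R;
  cstar_scaleAl : forall (a : Cx R) (x y : A),
    a *: cstar_mul x y = cstar_mul (a *: x) y;
  cstar_scaleAr : forall (a : Cx R) (x y : A),
    a *: cstar_mul x y = cstar_mul x (a *: y);
  cstar_starK : involutive cstar_star;
  cstar_starD : {morph cstar_star : x y / x + y};
  cstar_starZ : forall (a : Cx R) (x : A),
    cstar_star (a *: x) = a^* *: cstar_star x;
  cstar_starM : forall x y : A,
    cstar_star (cstar_mul x y) = cstar_mul (cstar_star y) (cstar_star x);
  cstar_normM : forall x y : A, `|cstar_mul x y| <= `|x| * `|y|;
  cstar_identity : forall x : A, `|cstar_mul (cstar_star x) x| = `|x| ^+ 2
}.

#[short(type="cstarAlgType")]
HB.structure Definition CStarAlgebra (R : realType) :=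
  {A of CompleteNormedModule (Cx R) A &
   CompleteNormedModule_isCStarAlgebra R A}.

#[non_forgetful_inheritance]
HB.instance Definition _ (R : realType) (A : cstarAlgType R) :=
  GRing.Zmodule_isPzRing.Build A (@cstar_mulA R A) (@cstar_mul1l R A)
    (@cstar_mul1r R A) (@cstar_mulDl R A) (@cstar_mulDr R A).

#[non_forgetful_inheritance]
HB.instance Definition _ (R : realType) (A : cstarAlgType R) :=
  PzRing_isStarRing.Build A (@cstar_starK R A) (@cstar_starD R A)
    (@cstar_starM R A).

(* Positivity in a C*-algebra only involves its *-ring structure; in this form
   it applies to matrix algebras over A and over B(H) without writing down
   their C*-norms. *)
Definition positive (A : starRingType) (x : A) : Prop :=
  exists y, x = star y * y.

Definition star_hom (R : realType) (A : cstarAlgType R) (K : hilbertType R)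
    (f : A -> bop K K) : Prop :=
  [/\ linear f, monoid_morphism f & forall a, f (star a) = adjoint (f a)].

Definition unitary (R : realType) (H K : hilbertType R) (U : bop H K) : Prop :=
  adjoint U \ob U = bop_id H /\ U \ob adjoint U = bop_id K.

Definition lspan (C : pzRingType) (V : lmodType C) (S : set V) : set V :=
  [set v | exists (N : nat) (c : 'I_N -> C) (x : 'I_N -> V),
     (forall i, S (x i)) /\ v = \sum_(i < N) c i *: x i].

(* A k-tuple (x_1, ..., x_k) is a function on 'I_k, with x_l at index l - 1. *)

Definition multilinear (C : pzRingType) (k : nat) (U V : lmodType C)
    (f : ('I_k -> U) -> V) : Prop :=
  forall (x : 'I_k -> U) (l : 'I_k),
    linear (fun u : U => f (@dfwith _ (fun=> U) x l u)).

(* The indices (i, r_1, ..., r_(k-1), j) are the values r 0, ..., r k of r. *)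
Definition block_map (k n : nat) (A : Type) (B : nmodType)
    (phi : 'I_n -> 'I_n -> ('I_k -> A) -> B) (M : 'I_k -> 'M[A]_n) : 'M[B]_n :=
  \matrix_(i, j)
    \sum_(r : {ffun 'I_k.+1 -> 'I_n} | (r ord0 == i) && (r ord_max == j))
      phi i j (fun l : 'I_k => M l (r (inord l)) (r (inord l.+1))).

Definition amplification (k t : nat) (C : Type) (D : nmodType)
    (Phi : ('I_k -> C) -> D) : ('I_k -> 'M[C]_t) -> 'M[D]_t :=
  block_map (fun _ _ : 'I_t => Phi).

Definition kpositive (k : nat) (C D : starRingType)
    (Phi : ('I_k -> C) -> D) : Prop :=
  forall x : 'I_k -> C,
    (forall l, x l = star (x (rev_ord l))) ->
    (odd k -> forall l : 'I_k, l = k./2 :> nat -> positive (x l)) ->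
    positive (Phi x).

Definition completely_positive (k : nat) (C D : starRingType)
    (Phi : ('I_k -> C) -> D) : Prop :=
  forall t : nat, (0 < t)%N -> kpositive (amplification (t := t) Phi).

(* Both parities at once: k./2 is m - 1 for k = 2m - 1 and m for k = 2m.  Only
   the values of c at the first k./2 indices are used. *)
Definition kinvariant (k : nat) (C : pzRingType) (D : Type)
    (Phi : ('I_k -> C) -> D) : Prop :=
  forall a c : 'I_k -> C,
    Phi (fun l => if (l < k./2)%N then a l * c l else a l) =
    Phi (fun l => if (rev_ord l < k./2)%N then c (rev_ord l) * a l else a l).

Fact uphalf_leq (k : nat) : (k.+1./2 <= k)%N.
Proof. by rewrite leq_half_double ltnS -addnn leq_addr. Qed.

(* The argument of pi_(s+1): for p = m - 1 - s, the product a_p a_(k-1-p), with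
   zero-based indices, or a_p alone when p is the middle index. *)
Definition folded_arg (k : nat) (A : pzRingType) (a : 'I_k -> A)
    (s : 'I_(k.+1./2)) : A :=
  let p := widen_ord (uphalf_leq k) (rev_ord s) in
  if p == rev_ord p then a p else a p * a (rev_ord p).

Section Stinespring.
Variables (R : realType) (A : cstarAlgType R) (H K : hilbertType R).
Variables (n k : nat) (phi : 'I_n -> 'I_n -> ('I_k -> A) -> bop H H).
Variables (pi : 'I_(k.+1./2) -> A -> bop K K) (V : 'I_n -> bop H K).

Definition stinespring_triple : Prop :=
  [/\ forall s, star_hom (pi s),
      forall s s' a b, s != s' -> pi s a * pi s' b = pi s' b * pi s a &
      forall i j a, phi i j a =
        adjoint (V i) \ob (\prod_(s < k.+1./2) pi s (folded_arg a s)) \ob V j].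

Definition minimal_triple : Prop :=
  closure (lspan [set x : K | exists (a : 'I_(k.+1./2) -> A) (h : 'I_n -> H),
    x = (\prod_(s < k.+1./2) pi s (a s)) (\sum_(i < n) V i (h i))]) = setT.

End Stinespring.

(* Main.v *)
(* The inner products of the vectors
     pi_1(a_1) ... pi_m(a_m) (V_1 h_1 + ... + V_n h_n)
   depend only on phi: the pi_s have commuting ranges, so moving one product
   across the inner product turns the pair into the single product of the
   pi_s(b_s^* a_s), and every m-tuple is the folding of some k-tuple.  For two
   minimal triples these families are total with equal Gram matrices, so matching
   them extends to a unitary; both conclusions hold by checking them on the
   families. *)
Require Import Defs.
From mathcomp Require Import all_boot all_order all_algebra.
From mathcomp Require Import boolp classical_sets topology normedtype.
From mathcomp Require Import reals ring zify.

Set Implicit Arguments.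
Unset Strict Implicit.
Unset Printing Implicit Defensive.

Import Order.TTheory GRing.Theory Num.Theory.
Import numFieldNormedType.Exports.

Local Open Scope ring_scope.

Lemma bop_sum (R : realType) (K L : hilbertType R) (P : bop K L) I (r : seq I)
    (F : I -> K) :
  P (\sum_(i <- r) F i) = \sum_(i <- r) P (F i).
Proof. exact: linear_sum. Qed.

(** * Total families with equal Gram matrices and the unitary matching them *)

Section GramUnitary.
Variables (R : realType) (T : Type).
Implicit Types (K : hilbertType R) (s : seq (Cx R * T)).

(** Coefficients and indices form a list kept apart from the vectors, so that one [s] can be
    evaluated in two spaces. *)
Definition lincomb K (x : T -> K) s : K := \sum_(p <- s) p.1 *: x p.2.

Lemma lincomb_cat K (x : T -> K) s s' :
  lincomb x (s ++ s') = lincomb x s + lincomb x s'.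
Proof. exact: big_cat. Qed.

Lemma lincomb_scale K (x : T -> K) (a : Cx R) s :
  lincomb x [seq (a * p.1, p.2) | p <- s] = a *: lincomb x s.
Proof.
rewrite /lincomb big_map scaler_sumr.
by apply: eq_bigr => p _; rewrite scalerA.
Qed.

Definition total_family K (x : T -> K) : Prop :=
  forall (y : K) (e : Cx R), 0 < e -> exists s, `|y - lincomb x s| < e.

Lemma total_closure_lspan K (x : T -> K) :
  closure (lspan (range x)) = setT -> total_family x.
Proof.
move=> cl y e e0; have : closure (lspan (range x)) y by rewrite cl.
move=> /(_ _ (nbhsx_ballx y e e0)) [_ [[N [c [z [zx ->]]]]]].
rewrite -ball_normE /= => yz.
have /choice[t tE] : forall i, exists t, x t = z i.
  by move=> i; have [t _ <-] := zx i; exists t.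
exists [seq (c i, t i) | i <- index_enum 'I_N].
rewrite /lincomb big_map; under eq_bigr do rewrite tE; exact: yz.
Qed.

Lemma total_bop_eq K L (x : T -> K) (P Q : bop K L) :
  total_family x -> (forall t, P (x t) = Q (x t)) -> P = Q.
Proof.
move=> tx PQ; apply: bop_ext => y; apply/eqP; rewrite -subr_eq0.
have DE z : P z - Q z = (P - Q) z by [].
rewrite DE; have [M M0 DM] := bop_bounded (P - Q).
rewrite -normr_eq0 eq_le normr_ge0 andbT; apply/ler_addgt0Pr => e e0.
(* As [P - Q] vanishes on the span and has bound [M], approximating [y] within [e / M] bounds its
   value at [y] by [e]. *)
have [s ys] := tx y (e / M) (divr_gt0 e0 M0).
have D0 : (P - Q) (lincomb x s) = 0.
  suff PQs : P (lincomb x s) = Q (lincomb x s) by rewrite -DE PQs subrr.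
  by rewrite /lincomb !bop_sum; apply: eq_bigr => p _; rewrite !linearZ_LR;
    congr (_ *: _); exact: PQ.
have -> : (P - Q) y = (P - Q) (y - lincomb x s).
  transitivity ((P - Q) (y - lincomb x s) + (P - Q) (lincomb x s)).
    by rewrite -[X in (P - Q) X](subrK (lincomb x s)); exact: linearD.
  by rewrite D0 addr0.
rewrite add0r; apply: le_trans (DM _) _.
by rewrite mulrC -ler_pdivlMr// ltW.
Qed.

(* [gram_rel x1 x2 y z] says that [(y, z)] lies in the closure of the span of
   the pairs [(x1 t, x2 t)]: this is the graph of the unitary to be built. *)
Definition gram_rel K1 K2 (x1 : T -> K1) (x2 : T -> K2) (y : K1) (z : K2) :=
  forall e : Cx R, 0 < e ->
    exists s, `|y - lincomb x1 s| < e /\ `|z - lincomb x2 s| < e.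

Lemma gram_relC K1 K2 (x1 : T -> K1) (x2 : T -> K2) y z :
  gram_rel x1 x2 y z -> gram_rel x2 x1 z y.
Proof. by move=> yz e /yz[s []]; exists s. Qed.

Lemma gram_rel_lin K1 K2 (x1 : T -> K1) (x2 : T -> K2) (a : Cx R) y z y' z' :
  gram_rel x1 x2 y z -> gram_rel x1 x2 y' z' ->
  gram_rel x1 x2 (a *: y + y') (a *: z + z').
Proof.
have lin K (u u' v v' : K) (d : Cx R) : 0 < d -> `|u - v| < d ->
    `|u' - v'| < d -> `|(a *: u + u') - (a *: v + v')| < (`|a| + 1) * d.
  move=> d0 uv u'v'; rewrite opprD addrACA -scalerBr.
  apply: le_lt_trans (ler_normD _ _) _; rewrite mulrDl mul1r.
  by apply: ler_ltD => //; rewrite normrZ ler_wpM2l// ltW.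
move=> yz yz' e e0.
(* The [1] accounts for the error of the second summand and keeps the divisor positive when
   [a = 0]. *)
have a0 : 0 < `|a| + 1 by rewrite ltr_wpDl.
have d0 : 0 < e / (`|a| + 1) by rewrite divr_gt0.
have [s [ys zs]] := yz _ d0; have [s' [ys' zs']] := yz' _ d0.
exists ([seq (a * p.1, p.2) | p <- s] ++ s').
rewrite !lincomb_cat !lincomb_scale.
have -> : e = (`|a| + 1) * (e / (`|a| + 1)) by rewrite mulrC divfK// gt_eqF.
by split; apply: lin.
Qed.

Lemma gram_rel_gen K1 K2 (x1 : T -> K1) (x2 : T -> K2) t :
  gram_rel x1 x2 (x1 t) (x2 t).
Proof.
move=> e e0; exists [:: (1, t)].
by rewrite /lincomb !big_seq1/= !scale1r !subrr !normr0.
Qed.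

Section EqualGram.
Context {K1 K2 : hilbertType R} {x1 : T -> K1} {x2 : T -> K2}.
Hypothesis gram : forall t t', dotp (x1 t) (x1 t') = dotp (x2 t) (x2 t').

Lemma gram_lincomb_dotp s s' :
  dotp (lincomb x1 s) (lincomb x1 s') =
  dotp (lincomb x2 s) (lincomb x2 s').
Proof.
rewrite /lincomb; elim: s => [|p s IHs].
  by rewrite !big_nil dotpC dotpr0 [RHS]dotpC dotpr0.
rewrite !big_cons !dotpDl !dotpZl IHs; congr (_ * _ + _).
elim: s' {IHs} => [|q s' IHs']; first by rewrite !big_nil !dotpr0.
by rewrite !big_cons !dotpDr !dotpZr gram IHs'.
Qed.

Lemma gram_lincomb_norm s : `|lincomb x1 s| = `|lincomb x2 s|.
Proof.
by apply/eqP; rewrite -(@eqrXn2 _ 2)// !dotp_normE gram_lincomb_dotp.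
Qed.

Lemma gram_rel_norm_le y z : gram_rel x1 x2 y z -> `|y| <= `|z|.
Proof.
move=> yz; apply/ler_addgt0Pr => e e0.
have [s [/ltW ys /ltW zs]] := yz (e / 2) (divr_gt0 e0 (ltr0n _ 2)).
have c2z : `|lincomb x2 s| <= e / 2 + `|z|.
  rewrite -[lincomb x2 s](subrK z); apply: le_trans (ler_normD _ _) _.
  by rewrite lerD2r distrC.
rewrite -[y](subrK (lincomb x1 s)); apply: le_trans (ler_normD _ _) _.
rewrite gram_lincomb_norm; apply: le_trans (lerD ys c2z) _.
by rewrite addrA -splitr addrC.
Qed.

(** Completeness of [K2]: norms of combinations agree in both spaces, so the images of combinations
    approaching [y] form a Cauchy filter, and [z] is its limit. *)
Lemma gram_rel_exists : total_family x1 ->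
  forall y, exists z, gram_rel x1 x2 y z.
Proof.
move=> tx y.
pose B (e : Cx R) : set K2 :=
  [set lincomb x2 s | s in [set s | `|y - lincomb x1 s| < e]]%classic.
pose F := filter_from [set e : Cx R | 0 < e]%classic B.
have FF : ProperFilter F.
  apply: filter_from_proper; last first.
    by move=> e e0; have [s ys] := tx y e e0; exists (lincomb x2 s), s.
  apply: filter_from_filter; first by exists 1; exact: ltr01.
  move=> e1 e2 /= e10 e20.
  have /orP[le|le] : (e1 <= e2) || (e2 <= e1) by
    exact: real_comparable (gtr0_real e10) (gtr0_real e20).
    exists e1 => // _ [s ys <-]; split; exists s => //=.
    exact: lt_le_trans ys le.
  exists e2 => // _ [s ys <-]; split; exists s => //=.
  exact: lt_le_trans ys le.
have /cauchy_cvg/cvg_ex[z Fz] : cauchy F.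
  apply/cauchyP => e e0.
  have d0 : 0 < e / 2 by rewrite divr_gt0.
  have [s ys] := tx y _ d0.
  exists (lincomb x2 s), (e / 2) => // _ [s' ys' <-].
  (* The difference of two combinations is again a combination, so its norm can be computed in
     [K1]. *)
  rewrite -ball_normE /= -scaleN1r -lincomb_scale -lincomb_cat.
  rewrite -gram_lincomb_norm lincomb_cat lincomb_scale scaleN1r.
  rewrite -(subrK y (lincomb x1 s)) -addrA.
  apply: le_lt_trans (ler_normD _ _) _.
  by rewrite [e]splitr ltrD// distrC.
exists z => e e0.
have FB : F (B e) by exists e.
have [_ [[s ys <-]]] := filter_ex (filterI FB (Fz _ (nbhsx_ballx z e e0))).
by rewrite -ball_normE /= => zs; exists s.
Qed.

End EqualGram.

Lemma gram_rel_norm K1 K2 (x1 : T -> K1) (x2 : T -> K2) :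
  (forall t t', dotp (x1 t) (x1 t') = dotp (x2 t) (x2 t')) ->
  forall y z, gram_rel x1 x2 y z -> `|y| = `|z|.
Proof.
move=> gram y z yz; apply/le_anti/andP; split; first exact: gram_rel_norm_le yz.
by apply: gram_rel_norm_le (gram_relC yz) => t t'; rewrite gram.
Qed.

Lemma gram_rel_dotp K1 K2 (x1 : T -> K1) (x2 : T -> K2) :
  (forall t t', dotp (x1 t) (x1 t') = dotp (x2 t) (x2 t')) ->
  forall y z y' z', gram_rel x1 x2 y z -> gram_rel x1 x2 y' z' ->
  dotp y y' = dotp z z'.
Proof.
move=> gram y z y' z' yz yz'.
have nE := gram_rel_norm gram.
(* Polarization: the norms of [D *: y' + y] and [D *: z' + z] agree. *)
pose D := dotp y y' - dotp z z'.
have : `|D *: y' + y| ^+ 2 = `|D *: z' + z| ^+ 2.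
  by congr (_ ^+ 2); apply: nE; exact: gram_rel_lin.
rewrite !dotp_normE !(dotpDl, dotpDr, dotpZl, dotpZr) -!dotp_normE.
rewrite (nE _ _ yz) (nE _ _ yz') (dotpC y' y) (dotpC z' z) => E.
have DJ : D^* = (dotp y y')^* - (dotp z z')^* by rewrite /D rmorphB.
(* With [D] as coefficient, the cross terms of the two expansions differ by exactly [2 |D|^2], which
   handles real and imaginary parts at once. *)
suff : D * D^* + D * D^* == 0.
  by rewrite -mulr2n mulrn_eq0 mulf_eq0 conjC_eq0 orbb subr_eq0 => /eqP.
have -> : D * D^* + D * D^* = D * ((dotp y y')^* - (dotp z z')^*) +
    D^* * (dotp y y' - dotp z z') by rewrite -DJ -/D [D^* * D]mulrC.
move/eqP: E; rewrite -subr_eq0 => /eqP E; rewrite -[X in _ == X]E.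
by apply/eqP; ring.
Qed.

(** The relation is symmetric in the two families, so the map [W] obtained in the opposite direction
    is both the adjoint and the inverse of [U]. *)
Lemma gram_unitary K1 K2 (x1 : T -> K1) (x2 : T -> K2) :
  (forall t t', dotp (x1 t) (x1 t') = dotp (x2 t) (x2 t')) ->
  total_family x1 -> total_family x2 ->
  exists2 U : bop K1 K2, unitary U & forall t, U (x1 t) = x2 t.
Proof.
move=> gram tx1 tx2.
have gram' t t' : dotp (x2 t) (x2 t') = dotp (x1 t) (x1 t') by rewrite gram.
have [U UP] := choice (gram_rel_exists gram tx1).
have [W WP] := choice (gram_rel_exists gram' tx2).
(* The difference of two partners of [y] is related to [0], hence has norm [0]. *)
have uniq y z z' : gram_rel x1 x2 y z -> gram_rel x1 x2 y z' ->
    z = z'.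
  move=> yz yz'; have := gram_rel_lin (-1) yz yz'.
  rewrite !scaleN1r addNr => /(gram_rel_norm gram)/esym/eqP.
  by rewrite normr0 normr_eq0 addrC subr_eq0 => /eqP.
have UB : U \in bounded_op.
  apply: bounded_opP.
    by move=> a y y'; apply: (uniq (a *: y + y')) => //; exact: gram_rel_lin.
  by exists 1 => y; rewrite mul1r (gram_rel_norm gram (UP y)).
have adjU z : adjoint (Bop UB) z = W z.
  apply: dotp_injr => y; rewrite -adjointP /=.
  exact/esym/(gram_rel_dotp gram (UP y))/gram_relC.
have UW z : U (W z) = z by apply: (uniq (W z)) => //; exact: gram_relC.
exists (Bop UB); last first.
  by move=> t; apply: (uniq (x1 t)) => //=; exact: gram_rel_gen.
split; apply: bop_ext => y; rewrite /= adjU// -[RHS]/y.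
(* What remains is [W (U y) = y]: both vectors are related to [U y], so they have the same inner
   product with every [y']. *)
apply: dotp_injr => y'.
by rewrite (gram_rel_dotp gram (UP y') (gram_relC (WP _)))
  (gram_rel_dotp gram (UP y') (UP y)).
Qed.

End GramUnitary.

(** * Ordered products of commuting factors *)

(** [F i] and [G i] may fail to commute: in the induction [G ord0] has to pass only the [F j] with
    [j] nonzero. *)
Lemma prodrM_offdiag_comm (B : pzRingType) m (F G : 'I_m -> B) :
  (forall i j, i != j -> GRing.comm (F i) (G j)) ->
  \prod_(i < m) (F i * G i) = (\prod_(i < m) F i) * \prod_(i < m) G i.
Proof.
elim: m F G => [|m IH] F G FG; first by rewrite !big_ord0 mulr1.
rewrite !big_ord_recl IH => [|i j ij]; last first.
  by apply: FG; rewrite (inj_eq lift_inj).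
rewrite -!mulrA; congr (_ * _); rewrite !mulrA; congr (_ * _).
by apply: commr_prod => i _; apply/commr_sym/FG.
Qed.

Lemma star1 (B : starRingType) : star 1 = 1 :> B.
Proof. by rewrite -[LHS]mulr1 -[X in _ * X]starK -starM mulr1 starK. Qed.

(** [star] reverses the order of the factors, and commutation restores it. *)
Lemma star_prod_comm (B : starRingType) m (F : 'I_m -> B) :
  (forall i j, i != j -> GRing.comm (star (F i)) (star (F j))) ->
  star (\prod_(i < m) F i) = \prod_(i < m) star (F i).
Proof.
elim: m F => [|m IH] F FF; first by rewrite !big_ord0 star1.
rewrite !big_ord_recl starM IH => [|i j ij]; last first.
  by apply: FF; rewrite (inj_eq lift_inj).
by apply/commr_sym/commr_prod => i _; apply: FF.
Qed.

(** * The Gram matrix of a Stinespring triple *)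

Section TripleGram.
Context {R : realType} {A : cstarAlgType R} {H : hilbertType R} {n k : nat}.
Context {phi : 'I_n -> 'I_n -> ('I_k -> A) -> bop H H}.

(* A right inverse of [folded_arg]: [rev_ord] undoes the reversal of indices in
   [folded_arg], and [1] fills the positions beyond the middle. *)
Definition unfold_arg (a : 'I_(k.+1./2) -> A) (l : 'I_k) : A :=
  if insub (l : nat) is Some p then a (rev_ord p) else 1.

Lemma unfold_argK a s : folded_arg (unfold_arg a) s = a s.
Proof.
have unfoldE p : unfold_arg a (widen_ord (Defs.uphalf_leq k) (rev_ord p)) = a p.
  rewrite /unfold_arg; case: insubP => [q _ /= qE|].
    by rewrite (_ : q = rev_ord p) ?rev_ordK//; exact: val_inj.
  by move=> /negP[]; exact: (ltn_ord (rev_ord p)).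
rewrite /folded_arg unfoldE; set p := widen_ord _ _.
have [//|pp] := eqVneq p (rev_ord p).
rewrite /unfold_arg; case: insubP => [q qk _|_]; last by rewrite mulr1.
case/negP: pp; apply/eqP/val_inj => /=.
(* The mirror position is [k - k.+1./2 + s]; it is below [k.+1./2] only if [k] is odd and [s = 0],
   and then [p] is the middle index. *)
by move: qk => /=; have := ltn_ord s; have := odd_double_half k.+1; lia.
Qed.

Definition triple_vec (K : hilbertType R) (pi : 'I_(k.+1./2) -> A -> bop K K)
    (V : 'I_n -> bop H K) (t : ('I_(k.+1./2) -> A) * ('I_n -> H)) : K :=
  (\prod_(s < k.+1./2) pi s (t.1 s)) (\sum_(i < n) V i (t.2 i)).

Section OneTriple.
Context {K : hilbertType R} { pi : 'I_(k.+1./2) -> A -> bop K K}.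
Context {V : 'I_n -> bop H K}.
Hypothesis triple : stinespring_triple phi pi V.

Lemma triple_prodM a b :
  \prod_(s < k.+1./2) pi s (a s * b s) =
  (\prod_(s < k.+1./2) pi s (a s)) * \prod_(s < k.+1./2) pi s (b s).
Proof.
have [hom comm _] := triple.
rewrite -prodrM_offdiag_comm => [|i j ij]; last exact: comm.
by apply: eq_bigr => s _; have [_ [_ ->]] := hom s.
Qed.

Lemma triple_prod_comp a b x :
  (\prod_(s < k.+1./2) pi s (a s)) ((\prod_(s < k.+1./2) pi s (b s)) x) =
  (\prod_(s < k.+1./2) pi s (a s * b s)) x.
Proof. by rewrite triple_prodM. Qed.

Lemma triple_prod1 : \prod_(s < k.+1./2) pi s 1 = 1.
Proof.
have [hom _ _] := triple.
by apply: big1 => s _; have [_ [-> _]] := hom s.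
Qed.

Lemma triple_prod_adjoint a :
  adjoint (\prod_(s < k.+1./2) pi s (a s)) = \prod_(s < k.+1./2) pi s (star (a s)).
Proof.
have [hom comm _] := triple.
have piE s x : star (pi s x) = pi s (star x) by have [_ _ ->] := hom s.
rewrite [LHS]star_prod_comm => [|i j ij]; last by rewrite !piE; exact: comm.
by apply: eq_bigr => s _; rewrite piE.
Qed.

(** The right-hand side mentions only [phi], so any two triples have equal Gram matrices. The
    indices appear as [phi j i] because [V j], from the second argument, becomes the adjoint on the
    left. *)
Lemma triple_vec_dotp a h b g :
  dotp (triple_vec pi V (a, h)) (triple_vec pi V (b, g)) =
  \sum_(i < n) \sum_(j < n)
    dotp (phi j i (unfold_arg (fun s => star (b s) * a s)) (h i)) (g j).
Proof.
have [_ _ phiE] := triple.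
have dotp_suml I (r : seq I) (F : I -> K) z :
    dotp (\sum_(i <- r) F i) z = \sum_(i <- r) dotp (F i) z.
  elim: r => [|i r IH]; first by rewrite !big_nil dotpC dotpr0 conjC0.
  by rewrite !big_cons dotpDl IH.
have dotp_sumr I (r : seq I) (F : I -> K) z :
    dotp z (\sum_(i <- r) F i) = \sum_(i <- r) dotp z (F i).
  elim: r => [|i r IH]; first by rewrite !big_nil dotpr0.
  by rewrite !big_cons dotpDr IH.
rewrite /triple_vec; cbn [fst snd].
rewrite dotpC adjointP -dotpC triple_prod_adjoint triple_prod_comp.
rewrite bop_sum dotp_suml; apply: eq_bigr => i _.
rewrite dotp_sumr; apply: eq_bigr => j _.
rewrite phiE; cbn [bop_fun bop_comp comp]; rewrite [RHS]dotpC -adjointP -dotpC.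
by under [in RHS]eq_bigr do rewrite unfold_argK.
Qed.

(** The products act on the family by translating its index, independently of the triple. *)
Lemma triple_vec_prod a t :
  (\prod_(s < k.+1./2) pi s (a s)) (triple_vec pi V t) =
  triple_vec pi V (fun s => a s * t.1 s, t.2).
Proof. by rewrite /triple_vec /= triple_prodM. Qed.

(** The vectors [V i h] belong to the family, so an operator matching two families also matches the
    [V i]. *)
Lemma triple_vec_delta i h :
  triple_vec pi V (fun=> 1, fun j => if j == i then h else 0) = V i h.
Proof.
rewrite /triple_vec triple_prod1 /= (bigD1 i)//= eqxx.
by rewrite big1 ?addr0// => j /negPf ->; rewrite linear0.
Qed.

Lemma triple_vec_total : minimal_triple pi V -> total_family (triple_vec pi V).
Proof.
move=> min; apply: total_closure_lspan; rewrite -[RHS]min.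
congr (closure (lspan _)); apply/seteqP; split=> [_ [[a h] _ <-]|_ [a [h ->]]].
  by exists a, h.
by exists (a, h).
Qed.

End OneTriple.
End TripleGram.

Theorem theorem3p7 (R : realType) (A : cstarAlgType R) (H : hilbertType R)
    (n k : nat) (n_gt0 : (0 < n)%N) (k_gt0 : (0 < k)%N)
    (phi : 'I_n -> 'I_n -> ('I_k -> A) -> bop H H)
    (phi_multilinear : forall i j, multilinear (phi i j))
    (phi_cp : completely_positive (block_map phi))
    (phi_inv : kinvariant (block_map phi))
    (K1 K2 : hilbertType R)
    (pi1 : 'I_(k.+1./2) -> A -> bop K1 K1) (V1 : 'I_n -> bop H K1)
    (pi2 : 'I_(k.+1./2) -> A -> bop K2 K2) (V2 : 'I_n -> bop H K2)
    (triple1 : stinespring_triple phi pi1 V1) (min1 : minimal_triple pi1 V1)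
    (triple2 : stinespring_triple phi pi2 V2) (min2 : minimal_triple pi2 V2) :
  exists U : bop K1 K2,
    [/\ unitary U,
        forall a : 'I_(k.+1./2) -> A,
          (\prod_(s < k.+1./2) pi2 s (a s)) \ob U =
          U \ob (\prod_(s < k.+1./2) pi1 s (a s)) &
        forall i : 'I_n, U \ob V1 i = V2 i].
Proof.
have tot1 := triple_vec_total min1; have tot2 := triple_vec_total min2.
have [|U Uunit UE] := gram_unitary _ tot1 tot2.
  by move=> [a h] [b g]; rewrite (triple_vec_dotp triple1) (triple_vec_dotp triple2).
exists U; split=> // [a|i].
  (* On the vector of index [t], both sides give the vector of the second family at the translated
     index. *)
  apply: (total_bop_eq tot1) => t /=.
  by rewrite UE (triple_vec_prod triple1) (triple_vec_prod triple2) UE.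
apply: bop_ext => h /=.
by rewrite -(triple_vec_delta triple1) UE (triple_vec_delta triple2).
Qed.
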